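(* Let $q$ be a positive integer. Then $\mathrm{Der}\,\mathcal{B}(q)=\mathrm{ad}\,\mathcal{B}(q)\oplus\mathcal{D}$, where $\mathcal{D}=\mathbb{C}D_0$. In particular, the first cohomology group of $\mathcal{B}(q)$ with coefficients in its adjoint module is one-dimensional, i.e. $\dim H^1(\mathcal{B}(q))=1$.
   Context: $\mathbb{Z}_+$ denotes the set of nonnegative integers. For a positive integer $q$, $\mathcal{B}(q)$ is the complex Lie algebra with basis $\{L_{\alpha,i}\mid \alpha\in\mathbb{Z},\ i\in\mathbb{Z}_+\}$ and bracket $[L_{\alpha,i},L_{\beta,j}]=(\beta(i+q)-\alpha(j+q))L_{\alpha+\beta,i+j}$. $\mathrm{Der}\,\mathcal{B}(q)$ is the space of derivations, i.e. linear maps $d:\mathcal{B}(q)\to\mathcal{B}(q)$ with $d([x,y])=[d(x),y]+[x,d(y)]$ for all $x,y$; $\mathrm{ad}\,\mathcal{B}(q)$ is the subspace of inner derivations $\mathrm{ad}_u:x\mapsto[u,x]$, $u\in\mathcal{B}(q)$. $H^1(\mathcal{B}(q))=\mathrm{Der}\,\mathcal{B}(q)/\mathrm{ad}\,\mathcal{B}(q)$. $D_0$ is the derivation of $\mathcal{B}(q)$ defined by $D_0(L_{\beta,j})=jL_{\beta,j}$ for $\beta\in\mathbb{Z}$, $j\in\mathbb{Z}_+$. *)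

(* Defs.v *)
From HB Require Import structures.
From mathcomp Require Import all_boot all_order all_algebra.
From mathcomp Require Import finmap ring.
From mathcomp Require Import boolp classical_sets functions reals complex.
From mathcomp.multinomials Require Import monalg.

Set Implicit Arguments.
Unset Strict Implicit.
Unset Printing Implicit Defensive.

Import GRing.Theory.

Local Open Scope classical_set_scope.
Local Open Scope ring_scope.
Local Open Scope quotient_scope.

Section LinearAlgebra.
Context (K : fieldType) (V : lmodType K).

Definition direct_sum (W U1 U2 : set V) : Prop :=
  W = [set u1 + u2 | u1 in U1 & u2 in U2] /\ U1 `&` U2 = [set 0].

Definition line (v : V) : set V := range (fun c : K => c *: v).

Definition has_dim (n : nat) : Prop :=
  exists e : 'I_n -> V,
    forall v, exists! c : 'I_n -> K, v = \sum_(i < n) c i *: e i.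

End LinearAlgebra.

(* MathComp provides quotients of Z-modules only. *)
Section LmoduleQuotient.
Context (K : fieldType) (V : lmodType K) (S : zmodClosed V).
Context (SZ : GRing.scaler_closed S).

Definition lquot of GRing.scaler_closed S : Type := Quotient.quot S.

Local Notation Q := (lquot SZ).

HB.instance Definition _ := GRing.Zmodule.on Q.
HB.instance Definition _ := EqQuotient.on Q.

Definition pi_lquot (v : V) : Q := \pi v.

Definition lquot_scale (a : K) (x : Q) : Q := pi_lquot (a *: repr x).

Lemma pi_lquot_surj (x : Q) : exists v, x = pi_lquot v.
Proof. by exists (repr x); rewrite /pi_lquot reprK. Qed.

Lemma pi_lquot_eqP (u v : V) : reflect (pi_lquot u = pi_lquot v) (u - v \in S).
Proof. by rewrite (@Quotient.idealrBE V S); exact: eqP. Qed.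

Lemma pi_lquotD : {morph pi_lquot : u v / u + v}.
Proof. exact: (@Quotient.pi_add V S). Qed.

Lemma lquot_scale_pi a v : lquot_scale a (pi_lquot v) = pi_lquot (a *: v).
Proof.
apply/pi_lquot_eqP; rewrite -scalerBr; apply: SZ.
by apply/pi_lquot_eqP; rewrite /pi_lquot reprK.
Qed.

Let scaleA a b x : lquot_scale a (lquot_scale b x) = lquot_scale (a * b) x.
Proof.
have [v ->] := pi_lquot_surj x.
by rewrite (lquot_scale_pi b) !lquot_scale_pi scalerA.
Qed.

Let scale1 : left_id 1 lquot_scale.
Proof.
by move=> x; have [v ->] := pi_lquot_surj x; rewrite lquot_scale_pi scale1r.
Qed.

Let scaleDr : right_distributive lquot_scale +%R.
Proof.
move=> a x y; have [u ->] := pi_lquot_surj x; have [v ->] := pi_lquot_surj y.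
by rewrite -pi_lquotD !lquot_scale_pi scalerDr pi_lquotD.
Qed.

Let scaleDl x : {morph lquot_scale^~ x : a b / a + b}.
Proof.
move=> a b; have [v ->] := pi_lquot_surj x.
by rewrite !lquot_scale_pi scalerDl pi_lquotD.
Qed.

HB.instance Definition _ :=
  GRing.Zmodule_isLmodule.Build K Q scaleA scale1 scaleDr scaleDl.

Lemma pi_lquot_linear : linear pi_lquot.
Proof. by move=> a u v; rewrite pi_lquotD -lquot_scale_pi. Qed.

End LmoduleQuotient.

HB.mixin Record Lmodule_isLieAlgebra (K : fieldType) L of GRing.Lmodule K L := {
  lie : L -> L -> L;
  lie_linearl : forall y, linear (lie^~ y);
  lie_linearr : forall x, linear (lie x);
  liexx : forall x, lie x x = 0;
  lie_jacobi : forall x y z,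
    lie x (lie y z) + lie y (lie z x) + lie z (lie x y) = 0
}.

#[short(type="lieAlgType")]
HB.structure Definition LieAlgebra (K : fieldType) :=
  { L of GRing.Lmodule K L & Lmodule_isLieAlgebra K L }.

Section Derivations.
Context (K : fieldType) (L : lieAlgType K).
Implicit Types (d : L -> L) (u x y : L).

Definition Der : set (L -> L) :=
  [set d | linear d /\ forall x y, d (lie x y) = lie (d x) y + lie x (d y)].

Definition ad u : L -> L := fun x => lie u x.

Definition adL : set (L -> L) := range ad.

Definition DerP : {pred L -> L} := mem Der.

Lemma Der_submod_closed : submod_closed DerP.
Proof.
have rD u : {morph lie u : x y / x + y}.
  by move=> x y; have := lie_linearr u 1 x y; rewrite !scale1r.
have lD u : {morph lie^~ u : x y / x + y}.
  by move=> x y; have := lie_linearl u 1 x y; rewrite !scale1r.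
have r0 u : lie u 0 = 0.
  by have := lie_linearr u (-1) 0 0; rewrite !scaleN1r !addNr.
have l0 u : lie 0 u = 0.
  by have := lie_linearl u (-1) 0 0; rewrite !scaleN1r !addNr.
have rZ a u x : lie u (a *: x) = a *: lie u x.
  by have := lie_linearr u a x 0; rewrite !addr0 r0 addr0.
have lZ a u x : lie (a *: x) u = a *: lie x u.
  by have := lie_linearl u a x 0; rewrite !addr0 /= l0 addr0.
split=> [|a d e]; rewrite !inE.
  split=> [b x y|x y]; rewrite /GRing.zero/=; first by rewrite scaler0 addr0.
  by rewrite l0 r0 addr0.
move=> [dl dM] [el eM].
have E z : (a *: d + e) z = a *: d z + e z by [].
split=> [b x y|x y]; rewrite !E.
  by rewrite dl el !scalerDr !scalerA [b * a]mulrC addrACA.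
by rewrite dM eM rD lD rZ lZ scalerDr addrACA.
Qed.

HB.instance Definition _ :=
  GRing.isSubmodClosed.Build K (L -> L) DerP Der_submod_closed.

Definition derivation : Type := {d : L -> L | d \in DerP}.

HB.instance Definition _ := [Choice of derivation by <:].
HB.instance Definition _ := [isSub of derivation for @sval _ _].
HB.instance Definition _ := [SubChoice_isSubLmodule of derivation by <:].

Definition innerP : {pred derivation} := mem [set d | adL (val d)].

Lemma inner_submod_closed : submod_closed innerP.
Proof.
split=> [|a d e]; rewrite !inE.
  exists 0 => //; apply/funext => x; rewrite raddf0 /ad.
  by have := lie_linearl x (-1) 0 0; rewrite !scaleN1r !addNr.
move=> [u _ uE] [v _ vE]; exists (a *: u + v) => //; apply/funext => x.
rewrite /ad [LHS](lie_linearl x a u v).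
by rewrite -[lie u x]/(ad u x) -[lie v x]/(ad v x) uE vE.
Qed.

HB.instance Definition _ :=
  GRing.isSubmodClosed.Build K derivation innerP inner_submod_closed.

Lemma inner_scaler_closed : GRing.scaler_closed innerP.
Proof. by move=> a d dI; rewrite rpredZ. Qed.

Definition H1 : Type := lquot inner_scaler_closed.

HB.instance Definition _ := GRing.Lmodule.on H1.

End Derivations.

Arguments Der {K} L.
Arguments adL {K} L.
Arguments H1 {K} L.

(* The linear map sending the basis vector << k >> to f k, locked so that
   conversion does not unfold brackets down to finitely supported functions. *)
HB.lock Definition lext (K : fieldType) (I : choiceType) (V : lmodType K)
    (f : I -> V) (x : {malg K[I]}) : V :=
  \sum_(k <- msupp x) x@_k *: f k.

Section LinearExtension.
Context (K : fieldType) (I : choiceType) (V : lmodType K).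
Implicit Types (f : I -> V) (x : {malg K[I]}).

Lemma lextE f x : lext f x = \sum_(k <- msupp x) x@_k *: f k.
Proof. by rewrite lext.unlock. Qed.

Lemma lextEw f x (D : {fset I}) : (msupp x `<=` D)%fset ->
  lext f x = \sum_(k <- D) x@_k *: f k.
Proof.
move=> le; rewrite lextE (big_fset_incl _ le) // => k _ kx.
by rewrite mcoeff_outdom // scale0r.
Qed.

Lemma lext_linear f : linear (lext f).
Proof.
move=> a x y; pose D := (msupp x `|` msupp y `|` msupp (a *: x + y))%fset.
rewrite !(@lextEw _ _ D); try by apply/fsubsetP => k; rewrite !inE => ->;
  rewrite ?orbT.
rewrite scaler_sumr -big_split /=; apply: eq_bigr => k _.
by rewrite mcoeffD mcoeffZ scalerDl scalerA.
Qed.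

Lemma lextU f k : lext f << k >> = f k.
Proof. by rewrite lextE msuppU oner_eq0 big_seq_fset1 mcoeffUU scale1r. Qed.

Lemma lext_uniq (g h : {malg K[I]} -> V) : linear g -> linear h ->
  (forall k, g << k >> = h << k >>) -> g =1 h.
Proof.
have lin (F : {malg K[I]} -> V) x : linear F -> F x = lext (F \o mkmalgU^~ 1) x.
  move=> lF; have F0 : F 0 = 0.
    by have := lF (-1) 0 0; rewrite !scaleN1r !addNr.
  rewrite {1}[x]monalgE lextE.
  elim/big_rec2: _ => // k v w _ IH.
  rewrite -IH -lF; congr (F (_ + _)).
  by apply/malgP => l; rewrite mcoeffZ !mcoeffU mulr_natr.
move=> lg lh gh x; rewrite (lin g x lg) (lin h x lh) !lextE; apply: eq_bigr => k _ /=.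
by rewrite gh.
Qed.

End LinearExtension.

(* The parameter q is a phantom for the carrier, the free K-module on the
   indices (alpha, i); it selects the bracket. *)
Definition blockLie (K : fieldType) (q : nat) : Type :=
  {malg K[(int * nat)%type]}.

Section BlockLieAlgebra.
Context (K : fieldType) (q : nat).

Local Notation blockLie := (blockLie K q).

HB.instance Definition _ := GRing.Lmodule.on blockLie.

Definition Lb (alpha : int) (i : nat) : blockLie := << (alpha, i) >>.

Definition block_coef (k l : int * nat) : K :=
  (l.1 * (k.2 + q)%:Z - k.1 * (l.2 + q)%:Z)%:~R.

Definition block_bracket (x y : blockLie) : blockLie :=
  lext (fun k => lext (fun l =>
    block_coef k l *: Lb (k.1 + l.1) (k.2 + l.2)) y) x.

Lemma block_bracketLL alpha beta i j :
  block_bracket (Lb alpha i) (Lb beta j) =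
  (beta * (i + q)%:Z - alpha * (j + q)%:Z)%:~R *: Lb (alpha + beta) (i + j).
Proof. by rewrite /block_bracket !lextU. Qed.

Let linl y : linear (block_bracket^~ y).
Proof. exact: lext_linear. Qed.

Let linr x : linear (block_bracket x).
Proof.
pose G y k := lext (fun l => block_coef k l *: Lb (k.1 + l.1) (k.2 + l.2)) y.
have E y : block_bracket x y = \sum_(k <- msupp x) x@_k *: G y k by exact: lextE.
move=> a y z; rewrite !E scaler_sumr -big_split /=; apply: eq_bigr => k _.
have -> : G (a *: y + z) k = a *: G y k + G z k by exact: lext_linear.
by rewrite scalerDr !scalerA [_ * a]mulrC.
Qed.

Let br0l y : block_bracket 0 y = 0.
Proof. by have := linl y (-1) 0 0; rewrite /= !scaleN1r !addNr. Qed.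

Let br0r x : block_bracket x 0 = 0.
Proof. by have := linr x (-1) 0 0; rewrite !scaleN1r !addNr. Qed.

Let brDl y u v :
  block_bracket (u + v) y = block_bracket u y + block_bracket v y.
Proof. by have := linl y 1 u v; rewrite /= !scale1r. Qed.

Let brDr x u v :
  block_bracket x (u + v) = block_bracket x u + block_bracket x v.
Proof. by have := linr x 1 u v; rewrite !scale1r. Qed.

Let brZl a x y : block_bracket (a *: x) y = a *: block_bracket x y.
Proof. by have := linl y a x 0; rewrite /= br0l !addr0. Qed.

Let brZr a x y : block_bracket x (a *: y) = a *: block_bracket x y.
Proof. by have := linr x a y 0; rewrite br0r !addr0. Qed.

Let comp_linear (f g : blockLie -> blockLie) :
  linear f -> linear g -> linear (f \o g).
Proof. by move=> lf lg a x y /=; rewrite lg lf. Qed.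

Let add_linear (f g : blockLie -> blockLie) :
  linear f -> linear g -> linear (fun x => f x + g x).
Proof. by move=> lf lg a x y; rewrite lg lf scalerDr addrACA. Qed.

Let zero_linear : linear (fun _ : blockLie => 0 : blockLie).
Proof. by move=> a x y; rewrite scaler0 addr0. Qed.

Let opp_linear (f : blockLie -> blockLie) :
  linear f -> linear (fun x => - f x).
Proof. by move=> lf a x y; rewrite lf opprD scalerN. Qed.

Let antisym x y : block_bracket x y = - block_bracket y x.
Proof.
move: x; apply: lext_uniq => [||k]; [exact: linl|exact/opp_linear/linr|].
move: y; apply: lext_uniq => [||l]; [exact: linr|exact/opp_linear/linl|].
case: k l => [a i] [b j]; rewrite !block_bracketLL.
by rewrite -scaleNr -mulrNz opprB [a + b]addrC [(i + j)%N]addnC.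
Qed.

Lemma blockLieE (x : blockLie) :
  x = \sum_(k <- msupp x) x@_k *: Lb k.1 k.2.
Proof.
rewrite -lextE.
apply: (@lext_uniq _ _ _ id (lext (fun k => Lb k.1 k.2))) => // [|[a i]].
  exact: lext_linear.
by rewrite lextU.
Qed.

Let alt x : block_bracket x x = 0.
Proof.
rewrite (blockLieE x).
apply: (big_ind (fun z => block_bracket z z = 0)) => [|u v Pu Pv|k _].
- exact: br0l.
- by rewrite brDl !brDr Pu Pv add0r addr0 (antisym v u) addrN.
- by rewrite brZl brZr block_bracketLL subrr scale0r !scaler0.
Qed.

Let jacobi_Lb (a b c : int) (i j h : nat) :
  block_bracket (Lb a i) (block_bracket (Lb b j) (Lb c h)) +
  block_bracket (Lb b j) (block_bracket (Lb c h) (Lb a i)) +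
  block_bracket (Lb c h) (block_bracket (Lb a i) (Lb b j)) = 0.
Proof.
rewrite !block_bracketLL !brZr !block_bracketLL !scalerA.
have -> : b + (c + a) = a + (b + c) by rewrite addrA addrC.
have -> : c + (a + b) = a + (b + c) by rewrite addrCA [c + b]addrC.
have -> : (j + (h + i) = i + (j + h))%N by rewrite addnA addnC.
have -> : (h + (i + j) = i + (j + h))%N by rewrite addnCA [(h + j)%N]addnC.
rewrite -!scalerDl -!intrM -!intrD [X in X%:~R](_ : _ = 0) ?scale0r //.
by rewrite !PoszD; ring.
Qed.

Let jacobi x y z :
  block_bracket x (block_bracket y z) + block_bracket y (block_bracket z x) +
  block_bracket z (block_bracket x y) = 0.
Proof.
move: x; apply: lext_uniq => [||k] //.
  apply: add_linear; [apply: add_linear|]; first exact: linl.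
    exact: (comp_linear (linr y) (linr z)).
  exact: (comp_linear (linr z) (linl y)).
move: y; apply: lext_uniq => [||l] //.
  apply: add_linear; [apply: add_linear|]; last 1 first.
  - exact: (comp_linear (linr z) (linr _)).
  - exact: (comp_linear (linr _) (linl z)).
  - exact: linl.
move: z; apply: lext_uniq => [||m] //.
  apply: add_linear; [apply: add_linear|]; last exact: linl.
    exact: (comp_linear (linr _) (linr _)).
  exact: (comp_linear (linr _) (linl _)).
case: k l m => [a i] [b j] [c h]; exact: jacobi_Lb.
Qed.

HB.instance Definition _ :=
  Lmodule_isLieAlgebra.Build K blockLie linl linr alt jacobi.

Lemma lie_Lb alpha beta i j :
  lie (Lb alpha i : blockLie) (Lb beta j : blockLie) =
  (beta * (i + q)%:Z - alpha * (j + q)%:Z)%:~R *: Lb (alpha + beta) (i + j).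
Proof. exact: block_bracketLL. Qed.

Definition D0 : blockLie -> blockLie := lext (fun k => k.2%:R *: Lb k.1 k.2).

Lemma D0_linear : linear D0.
Proof. exact: lext_linear. Qed.

Lemma D0_Lb beta j : D0 (Lb beta j) = j%:R *: Lb beta j.
Proof. by rewrite /D0 lextU. Qed.

End BlockLieAlgebra.

Arguments D0 : clear implicits.

(* Main.v *)
Require Import Defs.
From mathcomp Require Import all_boot all_order all_algebra.
From mathcomp Require Import boolp classical_sets functions reals complex.
From mathcomp Require Import ring zify.
From mathcomp.multinomials Require Import monalg.

(** Why the theorem holds. The element L_(0,0) acts diagonally: its bracket
    with L_(b,j) is b q L_(b,j), so it grades the algebra by the first index,
    while the second index is a grading too.

    Let d be a derivation. The bracket of u with L_(0,0) has coefficient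
    - a q u_(a,i) at (a,i), and that of u with L_(1,0) has coefficient
    (i + q) u_(0,i) at (1,i). All these factors but the one with a = 0 in the
    first family are nonzero, so the components u_(a,i), a <> 0, can be chosen
    to cancel d L_(0,0) outside the degree a = 0, and then the components
    u_(0,i) to cancel the part of d L_(1,0) of first degree 1. Such a u is a
    genuine element of the algebra because d L_(0,0) and d L_(1,0) have finite
    support ([Der_decomp]).

    After subtracting ad u, applying d to the eigenvector equation of L_(b,j)
    shows that d preserves the first degree ([Der_diag]). Its component of
    second degree m is then given by numbers f b j, the coefficient of
    d L_(b,j) at (b,j+m). The derivation rule is a functional equation for f,
    and with f 1 0 = 0 its only solutions are the multiples of f b j = j, which
    can be nonzero only if m = 0 ([block_weight_linear]). Hence d is a multiple
    of D0 ([Der_normalized]).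

    The sum is direct because ad u L_(0,1) never has a component along L_(0,1)
    while D0 fixes L_(0,1) ([D0_ad_eq0]); for the same reason the class of D0 is
    a basis of the first cohomology. Everything holds over any field of
    characteristic zero. *)

Set Implicit Arguments.
Unset Strict Implicit.
Unset Printing Implicit Defensive.

Import Order.TTheory GRing.Theory.

Local Open Scope ring_scope.

(** * The functional equation of a derivation of fixed bidegree *)

(** A linear combination step over a field with no order: the remaining side
    goal is a ring identity. *)
Lemma eq_by_multiple (R : pzRingType) (x y u v k : R) :
  u = v -> x - y = k * (u - v) -> x = y.
Proof. by move=> ->; rewrite subrr mulr0 => /eqP; rewrite subr_eq0 => /eqP. Qed.

Section FunctionalEquation.
Context (K : fieldType) (K0 : has_pchar0 K).

Lemma pchar0_intr_eq0 (m : int) : (m%:~R == 0 :> K) = (m == 0).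
Proof.
have /pcharf0P nat0 := K0.
by case: m => n; rewrite ?NegzE ?mulrNz ?oppr_eq0 -pmulrn nat0.
Qed.

Context (q : nat) (q_gt0 : (0 < q)%N) (m : int) (f : int -> nat -> K).

Hypothesis f_eq : forall (a b : int) (i j : nat),
  (b * (i + q)%:Z - a * (j + q)%:Z)%:~R * f (a + b) (i + j)%N =
  (b * (i%:Z + m + q%:Z) - a * (j + q)%:Z)%:~R * f a i +
  (b * (i + q)%:Z - a * (j%:Z + m + q%:Z))%:~R * f b j.
Hypothesis f_neg : forall (a : int) (i : nat), i%:Z + m < 0 -> f a i = 0.
Hypothesis f10 : f 1 0%N = 0.

Let castK := (@intrM K, @intrD K, @mulrNz K, @intrB K, PoszD).

(* Degree a = 0: the increment f b (i + j) - f b j depends neither on b <> 0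
   nor on j. *)
Let step0 (b : int) (i j : nat) : b != 0 ->
  (i%:Z + q%:Z)%:~R * (f b (i + j)%N - f b j) =
  (i%:Z + m + q%:Z)%:~R * f 0 i.
Proof.
move=> b0; apply: (@mulfI _ b%:~R); first by rewrite pchar0_intr_eq0.
have := f_eq 0 b i j; rewrite add0r !mul0r !subr0 !castK => E.
by apply: (eq_by_multiple (k := 1) E); ring.
Qed.

(* Degree (a, i) = (1, 0): a recursion in the first index. *)
Let step1 (b : int) (j : nat) :
  ((b - 1) * q%:Z - j%:Z)%:~R * f (b + 1) j =
  ((b - 1) * q%:Z - j%:Z - m)%:~R * f b j.
Proof.
have := f_eq 1 b 0 j; rewrite f10 mulr0 !add0n add0r [1 + b]addrC !castK => E.
by apply: (eq_by_multiple (k := 1) E); ring.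
Qed.

Let f00 : f 0 0%N = 0.
Proof.
have := @step0 1 0 0 isT; rewrite subrr mulr0 add0r => /esym/eqP.
rewrite mulf_eq0 pchar0_intr_eq0 => /orP[mq|/eqP//].
by apply: f_neg; lia.
Qed.

Let f_affine (b : int) (j : nat) : b != 0 -> f b j = f b 0%N + j%:R * f 1 1%N.
Proof.
move=> b0; elim: j => [|j IH]; first by rewrite mul0r addr0.
have D : f b (1 + j)%N - f b j = f 1 (1 + 0)%N - f 1 0%N.
  apply: (@mulfI _ (1%:Z + q%:Z)%:~R); first by rewrite pchar0_intr_eq0; lia.
  by rewrite !step0.
move: D; rewrite f10 subr0 addn0 add1n => /eqP; rewrite subr_eq => /eqP ->.
by rewrite IH mulrSr; ring.
Qed.

(* With the affine form in j, the recursion is an identity between polynomials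
   in j; comparing j = 0 and j = 1 isolates the linear coefficient. *)
Let f_succ (b : int) : b != 0 -> b + 1 != 0 ->
  f (b + 1) 0%N = f b 0%N + m%:~R * f 1 1%N.
Proof.
move=> b0 b1; have := step1 b 1.
rewrite (f_affine 1 b0) (f_affine 1 b1) !castK => E1.
have := step1 b 0; rewrite !castK => E0.
by apply: (eq_by_multiple (k := 1) (congr2 (fun x y => x - y) E0 E1)); ring.
Qed.

Let f11 : m%:~R * f 1 1%N = 0.
Proof.
have f2 := @f_succ 1 isT isT; have f3 := @f_succ 2 isT isT.
rewrite f10 add0r in f2.
have [m_neg|m_ge0] := ltP m 0; first by rewrite -f2 f_neg ?add0r.
apply: (@mulfI _ (q%:Z + m)%:~R); first by rewrite pchar0_intr_eq0; lia.
(* Substituting f 2 0 = m g and f 3 0 = 2 m g, where g = f 1 1, into the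
   recursion at b = 2 leaves (q + m) m g = 0. *)
have := step1 2 0.
rewrite f3 (_ : (2 : int) = 1 + 1) // f2 !castK => E.
by apply: (eq_by_multiple (k := 1) E); ring.
Qed.

Let f_zero (b : int) : b != 0 -> f b 0%N = 0.
Proof.
have succ c : c != 0 -> c + 1 != 0 -> f (c + 1) 0%N = f c 0%N.
  by move=> c0 c1; rewrite f_succ // f11 addr0.
case: b => [[//|n] _|n _].
  elim: n => [|n IH]; first exact: f10.
  by rewrite -addn1 PoszD succ //; lia.
(* The recursion does not cross b = 0, where the affine form in j is not
   available: the start b = -1 comes from (2 q + m) f (-1) 0 = 2 q f 0 0 = 0. *)
elim: n => [|n IH].
  have := step1 (-1) 0; rewrite addNr f00 mulr0 => /esym/eqP.
  rewrite mulf_eq0 pchar0_intr_eq0 => /orP[mq|/eqP//].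
  by apply: f_neg; lia.
by rewrite -succ // (_ : Negz n.+1 + 1 = Negz n) //; lia.
Qed.

(** The equation with a = 0 makes f b j affine in j with a slope g common to all
    b <> 0, and the one with (a, i) = (1, 0) gives f (b + 1) 0 = f b 0 + m g.
    Iterating from f 1 0 = 0 yields (q + m) m g = 0, hence m g = 0: for m < 0
    already f 2 0 = m g lies outside the algebra. All constant terms f b 0 then
    vanish, and the values at b = 0 follow from those at b = 1. *)
Lemma block_weight_linear :
  m%:~R * f 1 1%N = 0 /\ forall b j, f b j = j%:R * f 1 1%N.
Proof.
split=> [|b j]; first exact: f11.
have fb c k : c != 0 -> f c k = k%:R * f 1 1%N.
  by move=> c0; rewrite f_affine // f_zero // add0r.
have [->|/fb//] := eqVneq b 0.
(* At b = 0 the value is determined by b = 1 up to the factor j + m + q; when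
   this vanishes, j + m = - q < 0 puts f 0 j outside the algebra. *)
have [jmq|jmq] := eqVneq (j%:Z + m + q%:Z) 0.
  rewrite f_neg; last by lia.
  have/eqP := f11; rewrite mulf_eq0 pchar0_intr_eq0 => /orP[/eqP m0|/eqP->].
    by lia.
  by rewrite mulr0.
apply: (@mulfI _ (j%:Z + m + q%:Z)%:~R); first by rewrite pchar0_intr_eq0.
rewrite -(@step0 1 j 0) // addn0 f10 subr0 fb // !castK.
by apply: (eq_by_multiple (k := - j%:R) f11); ring.
Qed.

End FunctionalEquation.

(** * Bracket laws in an abstract Lie algebra *)

Section LieLaws.
Context (K : fieldType) (L : lieAlgType K).
Implicit Types (u x y : L) (k : K).

Lemma lieDl x y u : lie (x + y) u = lie x u + lie y u.
Proof. by have := lie_linearl u 1 x y; rewrite !scale1r. Qed.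

Lemma lieDr x y u : lie u (x + y) = lie u x + lie u y.
Proof. by have := lie_linearr u 1 x y; rewrite !scale1r. Qed.

Lemma lie0l u : lie 0 u = 0.
Proof. by have := lie_linearl u (-1) 0 0; rewrite !scaleN1r !addNr. Qed.

Lemma lie0r u : lie u 0 = 0.
Proof. by have := lie_linearr u (-1) 0 0; rewrite !scaleN1r !addNr. Qed.

Lemma lieZl k x u : lie (k *: x) u = k *: lie x u.
Proof. by have := lie_linearl u k x 0; rewrite lie0l !addr0. Qed.

Lemma lieZr k x u : lie u (k *: x) = k *: lie u x.
Proof. by have := lie_linearr u k x 0; rewrite lie0r !addr0. Qed.

Lemma lieC x y : lie x y = - lie y x.
Proof.
have := liexx (x + y); rewrite lieDl !lieDr !liexx addr0 add0r => /eqP.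
by rewrite addr_eq0 => /eqP.
Qed.

Lemma ad_Der u : Der L (ad u).
Proof.
split=> [|x y]; first exact: lie_linearr.
have := lie_jacobi u x y; rewrite /ad (lieC y (lie u x)) (lieC y u).
rewrite -scaleN1r lieZr scaleN1r => /eqP.
by rewrite -addrA addr_eq0 opprD !opprK addrC => /eqP.
Qed.

End LieLaws.

(** * Coefficients of brackets *)

Section Coefficients.
Context (K : fieldType) (q : nat).
Local Notation B := (blockLie K q).
Implicit Types (x y : B) (a b c : int) (i j : nat) (z : int).

(** The second index ranges over all integers, with value 0 below zero, so that
    bracketing with a basis vector is an unconditional shift of indices. *)
Definition coefLb x a z : K := if z is Posz i then mcoeff (a, i) x else 0.

Lemma coefLb_linear a z : linear (fun x => coefLb x a z : K^o).
Proof.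
move=> k x y; case: z => [i|n] /=; last by rewrite scaler0 addr0.
by rewrite mcoeffD mcoeffZ.
Qed.

Lemma coefLbD x y a z : coefLb (x + y) a z = coefLb x a z + coefLb y a z.
Proof. by have := coefLb_linear a z 1 x y; rewrite !scale1r. Qed.

Lemma coefLbZ k x a z : coefLb (k *: x) a z = k * coefLb x a z.
Proof. by case: z => [i|n] /=; rewrite ?mcoeffZ // mulr0. Qed.

Lemma coefLbB x y a z : coefLb (x - y) a z = coefLb x a z - coefLb y a z.
Proof. by rewrite -scaleN1r coefLbD coefLbZ mulN1r. Qed.

Lemma coefLb_Lb a i b z :
  coefLb (Lb K q a i) b z = ((a == b) && (i%:Z == z))%:R.
Proof. by case: z => [j|n] /=; rewrite ?mcoeffU ?andbF. Qed.

Lemma coefLb_neg x a z : z < 0 -> coefLb x a z = 0.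
Proof. by case: z. Qed.

Arguments coefLb : simpl never.

Lemma coefLb_inj x y :
  (forall a i, coefLb x a i = coefLb y a i) -> x = y.
Proof. by move=> xy; apply/malgP => -[a i]; exact: (xy a i). Qed.

Lemma coefLb_lie_r x b j c z :
  coefLb (lie x (Lb K q b j)) c z =
  (b * (z - j%:Z + q%:Z) - (c - b) * (j + q)%:Z)%:~R *
    coefLb x (c - b) (z - j%:Z).
Proof.
move: x; apply: (@lext_uniq K _ K^o) => [||[a i]].
- by move=> k x y; rewrite lie_linearl coefLb_linear.
- move=> k x y; rewrite coefLb_linear /GRing.scale /=; ring.
rewrite -[<< _ >>]/(Lb K q a i) lie_Lb coefLbZ !coefLb_Lb.
rewrite [a == c - b]eq_sym subr_eq [c == _]eq_sym.
rewrite [i%:Z == _]eq_sym subr_eq -PoszD [z == _]eq_sym.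
case: (altP (a + b =P c)) => [<-|_]; last by rewrite !mulr0.
case: (altP ((i + j)%:Z =P z)) => [<-|_]; last by rewrite !mulr0.
by rewrite (PoszD i j) (addrK j%:Z) (addrK b).
Qed.

Lemma coefLb_lie_l x b j c z :
  coefLb (lie (Lb K q b j) x) c z =
  ((c - b) * (j + q)%:Z - b * (z - j%:Z + q%:Z))%:~R *
    coefLb x (c - b) (z - j%:Z).
Proof.
by rewrite lieC -scaleN1r coefLbZ coefLb_lie_r mulN1r -mulNr -mulrNz opprB.
Qed.

(** Coefficients cannot be prescribed freely, as supports are finite; here the
    support of y bounds that of x, whatever the scaling factors s. *)
Lemma exists_coefLb (s : int -> nat -> K) y c :
  exists x : B, forall a i, coefLb x a i%:Z = s a i * coefLb y (a + c) i%:Z.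
Proof.
exists (lext (fun k => s (k.1 - c) k.2 *: Lb K q (k.1 - c) k.2) y) => a i.
move: y; apply: (@lext_uniq K _ K^o) => [||[b j]].
- by move=> k x y; rewrite lext_linear coefLb_linear.
- move=> k x y; rewrite coefLb_linear /GRing.scale /=; ring.
rewrite lextU -[<< _ >>]/(Lb K q b j) coefLbZ !coefLb_Lb /= subr_eq.
case: (altP (b =P a + c)) => [->|_]; last by rewrite !mulr0.
rewrite (addrK c) eqz_nat.
by case: (altP (j =P i)) => [->|_] //; rewrite !mulr0.
Qed.

(** * Derivations of the Block type algebra *)

Lemma Der_eq d1 d2 : linear d1 -> linear d2 ->
  (forall b j, d1 (Lb K q b j) = d2 (Lb K q b j)) -> d1 = d2 :> (B -> B).
Proof.
by move=> l1 l2 E; apply/funext; apply: lext_uniq => // -[b j]; exact: E.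
Qed.

Lemma D0_Der : Der B (D0 K q).
Proof.
split=> [|x y]; first exact: D0_linear.
have D0D u v : D0 K q (u + v) = D0 K q u + D0 K q v.
  by have := @D0_linear K q 1 u v; rewrite !scale1r.
have D0Z k u : D0 K q (k *: u) = k *: D0 K q u.
  have := @D0_linear K q k u 0; rewrite addr0 => ->.
  by have := @D0_linear K q (-1) 0 0;
    rewrite !scaleN1r !addNr => ->; rewrite addr0.
move: x; apply: lext_uniq => [k u v|k u v|[a i]].
- by rewrite lieDl lieZl D0D D0Z.
- by rewrite D0D D0Z !lieDl !lieZl scalerDr addrACA.
move: y; apply: lext_uniq => [k u v|k u v|[b j]].
- by rewrite lieDr lieZr D0D D0Z.
- by rewrite D0D D0Z !lieDr !lieZr scalerDr addrACA.
rewrite -[<< (a, i) >>]/(Lb K q a i) -[<< (b, j) >>]/(Lb K q b j).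
by rewrite lie_Lb D0Z !D0_Lb lieZl lieZr lie_Lb -scalerDl -natrD !scalerA mulrC.
Qed.

(** Every ad u kills the coefficient at (0,1) of L_(0,1), because the structure
    constant of L_(0,0) and L_(0,1) is zero; D0 has coefficient 1 there. *)
Lemma D0_ad_eq0 (k : K) (u : B) : ad u = k *: D0 K q -> k = 0.
Proof.
move=> /(congr1 (fun d : B -> B => coefLb (d (Lb K q 0 1)) 0 1)).
rewrite -[(k *: D0 K q) _]/(k *: D0 K q _) D0_Lb !coefLbZ coefLb_Lb /= !mulr1.
by rewrite -[ad u _]/(lie u _) coefLb_lie_r !subr0 !mul0r => <-.
Qed.

Section CharZero.
Context (K0 : has_pchar0 K) (q_gt0 : (0 < q)%N).

Section OneDerivation.
Context (d : B -> B) (dDer : Der B d).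

Lemma Der_coef a b i j c z :
  (b * (i + q)%:Z - a * (j + q)%:Z)%:~R *
    coefLb (d (Lb K q (a + b) (i + j))) c z =
  (b * (z - j%:Z + q%:Z) - (c - b) * (j + q)%:Z)%:~R *
    coefLb (d (Lb K q a i)) (c - b) (z - j%:Z) +
  ((c - a) * (i + q)%:Z - a * (z - i%:Z + q%:Z))%:~R *
    coefLb (d (Lb K q b j)) (c - a) (z - i%:Z).
Proof.
have [dl dM] := dDer.
have dZ k u : d (k *: u) = k *: d u.
  have := dl k u 0; rewrite addr0 => ->.
  by have := dl (-1) 0 0; rewrite !scaleN1r !addNr => ->; rewrite addr0.
have := dM (Lb K q a i) (Lb K q b j).
rewrite lie_Lb dZ => /(congr1 (fun x => coefLb x c z)).
by rewrite coefLbZ coefLbD coefLb_lie_r coefLb_lie_l.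
Qed.

(* These conditions normalize d modulo inner derivations: ad u satisfies both
   only for u = 0. *)
Hypothesis d00 : forall a z, a != 0 -> coefLb (d (Lb K q 0 0)) a z = 0.
Hypothesis d10 : forall z, coefLb (d (Lb K q 1 0)) 1 z = 0.

(** Applying d to the eigenvector equation of L_(b,j) under L_(0,0) and taking
    the coefficient at (c,z), the term with d L_(0,0) drops out as c - b <> 0,
    and what is left is that (b - c) q times the coefficient vanishes. *)
Lemma Der_diag b j c z : c != b -> coefLb (d (Lb K q b j)) c z = 0.
Proof.
move=> cb; have cb0 : c - b != 0 by rewrite subr_eq0.
have := Der_coef 0 b 0 j c z.
rewrite d00 // mulr0 !add0r !add0n !mul0r !subr0 => /eqP.
rewrite -subr_eq0 -mulrBl -intrB -mulrBl mulf_eq0 pchar0_intr_eq0 //.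
by rewrite mulf_eq0 subr_eq0 eq_sym (negPf cb) /= => /orP[|/eqP//]; lia.
Qed.

(* The component of d of second degree m, in the form to which the functional
   equation applies. *)
Let f m a i := coefLb (d (Lb K q a i)) a (i%:Z + m).

(** Only m = 0 can contribute, and there f b j is j times f 1 1, so f 1 1 for
    m = 0 is the multiple of D0. *)
Lemma Der_normalized : exists k, d = k *: D0 K q.
Proof.
have fP m : m%:~R * f m 1 1 = 0 /\ forall b j, f m b j = j%:R * f m 1 1.
  apply: (@block_weight_linear K K0 q q_gt0 m (f m)) => [a b i j|a i|].
  - have := Der_coef a b i j (a + b) ((i + j)%N%:Z + m).
    rewrite /f addrK [a + b - a]addrAC subrr add0r.
    have -> : (i + j)%N%:Z + m - j%:Z = i%:Z + m by lia.
    by have -> : (i + j)%N%:Z + m - i%:Z = j%:Z + m by lia.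
  - exact: coefLb_neg.
  - exact: d10.
exists (f 0 1 1); apply: Der_eq.
- exact: dDer.1.
- by move=> k x y; rewrite /= -![(_ *: D0 K q) _]/(_ *: D0 K q _) D0_linear
    scalerDr !scalerA mulrC.
move=> b j; apply: coefLb_inj => c i.
rewrite -[(_ *: D0 K q) _]/(_ *: D0 K q _) D0_Lb scalerA coefLbZ coefLb_Lb.
have [->|bc] := eqVneq c b; last first.
  by rewrite Der_diag // mulr0.
have -> : coefLb (d (Lb K q b j)) b i = f (i%:Z - j%:Z) b j.
  by rewrite /f addrC subrK.
have [m0 ->] := fP (i%:Z - j%:Z).
have [->|ji] := eqVneq i j.
  by rewrite subrr eqxx mulr1 mulrC.
move/eqP: m0; rewrite mulf_eq0 pchar0_intr_eq0 // subr_eq0 => /orP[|/eqP->].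
  by move=> /eqP[/eqP]; rewrite (negPf ji).
by rewrite [_ == _]eq_sym [_ == _](negPf ji) !mulr0.
Qed.

End OneDerivation.

(** The inner part is read off from d L_(0,0), where L_(0,0) sees the components
    of first degree a <> 0, and from d L_(1,0), where L_(1,0) sees those of
    first degree 0. *)
Lemma Der_decomp d : Der B d -> exists u k, d = ad u + k *: D0 K q.
Proof.
move=> dDer.
have [u1 u1E] := exists_coefLb
  (fun a _ => if a == 0 then 0 else - (a * q%:Z)%:~R^-1) (d (Lb K q 0 0)) 0.
have [u2 u2E] := exists_coefLb
  (fun a i => if a == 0 then (i + q)%:R^-1 else 0) (d (Lb K q 1 0)) 1.
have [k dE] : exists k, d - ad (u1 + u2) = k *: D0 K q.
  apply: Der_normalized => [|a [i|n] a0|[i|n]]; try exact: coefLb_neg.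
  - have : d - ad (u1 + u2) \in @DerP K B.
      by apply: rpredB; rewrite inE //; exact: ad_Der.
    by rewrite inE.
  - rewrite -[(d - _) _]/(d _ - lie _ _) coefLbB coefLb_lie_r coefLbD !subr0.
    rewrite u1E u2E (negPf a0) !mul0r !addr0 sub0r add0n mulrNz mulrA mulrNN.
    by rewrite divff ?mul1r ?subrr // pchar0_intr_eq0 // mulf_neq0 //; lia.
  - rewrite -[(d - _) _]/(d _ - lie _ _) coefLbB coefLb_lie_r coefLbD !subr0.
    rewrite !subrr u1E u2E eqxx !mul0r !add0r mul1r mulrA -PoszD.
    by rewrite divff ?mul1r ?subrr // pchar0_intr_eq0 //; lia.
exists (u1 + u2), k; by rewrite -dE addrC subrK.
Qed.

Theorem Der_direct_sum : direct_sum (Der B) (adL B) (line (D0 K q)).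
Proof.
have DkD0 k : k *: D0 K q \in @DerP K B by rewrite rpredZ // inE; exact: D0_Der.
split; apply/seteqP; split=> d /=.
- move=> /Der_decomp[u [k ->]].
  by exists (ad u); [exists u | exists (k *: D0 K q) => //; exists k].
- move=> [_ [u _ <-] [_ [k _ <-] <-]].
  have : ad u + k *: D0 K q \in @DerP K B.
    by rewrite rpredD // inE; exact: ad_Der.
  by rewrite inE.
- by move=> [[u _ <-] [k _ uE]]; rewrite -uE (D0_ad_eq0 (esym uE)) scale0r.
- move=> ->; split; last by exists 0 => //; rewrite scale0r.
  by exists 0 => //; apply/funext => x; exact: lie0l.
Qed.

(** * The first cohomology *)

Theorem H1_dim1 : has_dim (H1 B) 1.
Proof.
have D0P : D0 K q \in @DerP K B by rewrite inE; exact: D0_Der.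
pose e : derivation B := Sub (D0 K q) D0P.
pose cl (d : derivation B) : H1 B := pi_lquot (@inner_scaler_closed K B) d.
have clZ k d : cl (k *: d) = k *: cl d by rewrite /cl -lquot_scale_pi.
have valE (d : derivation B) (c : K) :
  val (d - c *: e) = val d - c *: D0 K q by [].
exists (fun=> cl e) => h.
have [d ->] := @pi_lquot_surj _ _ _ (@inner_scaler_closed K B) h.
have : Der B (val d) by have := valP d; rewrite inE.
move=> /Der_decomp[u [k dE]].
exists (fun=> k); split.
  rewrite big_ord1 -clZ; apply/pi_lquot_eqP; rewrite inE; exists u => //.
  by rewrite valE dE addrK.
move=> c; rewrite big_ord1 -clZ => /pi_lquot_eqP; rewrite inE => -[w _].
rewrite valE dE => E.
apply/funext => i; rewrite (ord1 i); apply/eqP; rewrite -subr_eq0; apply/eqP.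
apply: (@D0_ad_eq0 _ (w - u)); apply/funext => x.
rewrite /ad lieDl -scaleN1r lieZl scaleN1r -[lie w x]/(ad w x) E /=.
by rewrite scalerBl addrC -addrA addKr.
Qed.

End CharZero.
End Coefficients.

Theorem theorem3p1 (R : realType) (q : nat) (q_gt0 : (0 < q)%N) :
  direct_sum (Der (blockLie R[i] q)) (adL (blockLie R[i] q))
    (line (D0 R[i] q)) /\
  has_dim (H1 (blockLie R[i] q)) 1.
Proof.
have C0 : has_pchar0 R[i] := Num.Theory.pchar_num _.
by split; [exact: Der_direct_sum | exact: H1_dim1].
Qed.
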